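(* Let $\bm{\gamma}: I \to \mathbb{R}^3$ be a Frenet curve, i.e. a regular curve such that $\dot{\bm{\gamma}}(t)$ and $\ddot{\bm{\gamma}}(t)$ are linearly independent for all $t \in I$. Then $\bm{\gamma}$ admits a generalized Frenet frame.
   Context: All curves and maps are of class $C^\infty$; $I \subset \mathbb{R}$ is an interval; a dot denotes $d/dt$; $\langle\cdot,\cdot\rangle$ is the standard inner product on $\mathbb{R}^3$; $S^2$ is the unit sphere. Let $\Delta = \{(\bm{a},\bm{b}) \in S^2 \times S^2 \mid \langle \bm{a},\bm{b}\rangle = 0\}$. Legendre curve: a map $(\bm{\sigma},\bm{\nu}): I \to \Delta$ with $\langle \dot{\bm{\sigma}}(t), \bm{\nu}(t)\rangle = 0$ for all $t \in I$. A curve $\bm{\sigma}: I \to S^2$ is a frontal if there is $\bm{\nu}: I \to S^2$ such that $(\bm{\sigma},\bm{\nu})$ is a Legendre curve. Generalized Frenet frame: $\bm{\gamma}: I \to \mathbb{R}^3$ admits a generalized Frenet frame if there exist $\alpha: I \to \mathbb{R}$ and $\bm{t}: I \to S^2$ with $\dot{\bm{\gamma}}(t) = \alpha(t)\bm{t}(t)$ for all $t\in I$ and $\bm{t}$ is a frontal in $S^2$. *)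

(* Defs.v *)
From HB Require Import structures.
From mathcomp Require Import all_boot all_order all_algebra.
From mathcomp Require Import all_classical all_reals all_analysis.

Set Implicit Arguments.
Unset Strict Implicit.
Unset Printing Implicit Defensive.

Import Order.TTheory GRing.Theory Num.Theory.
Import numFieldNormedType.Exports.

Local Open Scope classical_set_scope.
Local Open Scope ring_scope.

(* A map on an interval I is represented by a total function on R of which
   only the values on I matter.  Accordingly d/dt is taken relatively to I: it
   is the usual derivative at interior points of I and the one-sided derivative
   at the endpoints that belong to I.

   If I is reduced to one point, the limit is along the improper filter and has
   the same (meaningless) value for all maps, so that [frenet_curve] below has
   no instance on such an I. *)
Section DerivativeOnInterval.
Context {R : realType} {V : normedModType R}.
Implicit Types (I : set R) (f : R -> V).

Definition diff_quot f (t s : R) : V := (s - t)^-1 *: (f s - f t).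

Definition derivable_on I f (t : R) : Prop :=
  cvg (diff_quot f t s @[s --> within I t^']).

Definition deriv_on I f (t : R) : V :=
  lim (diff_quot f t s @[s --> within I t^']).

(* C^infinity on I *)
Definition smooth_on I f : Prop :=
  forall (n : nat) (t : R), I t -> derivable_on I (iter n (deriv_on I) f) t.

End DerivativeOnInterval.

Section Curves.
Context {R : realType}.
Implicit Types (I : set R) (gamma sigma nu tau : R -> 'rV[R]_3).

Definition inner (u v : 'rV[R]_3) : R := \sum_(i < 3) u 0 i * v 0 i.

Definition unit_sphere : set 'rV[R]_3 := [set u | inner u u = 1].

Definition Delta : set ('rV[R]_3 * 'rV[R]_3) :=
  [set p | [/\ unit_sphere p.1, unit_sphere p.2 & inner p.1 p.2 = 0]].

Definition legendre_curve I sigma nu : Prop :=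
  [/\ smooth_on I sigma, smooth_on I nu,
      forall t, I t -> Delta (sigma t, nu t)
    & forall t, I t -> inner (deriv_on I sigma t) (nu t) = 0].

Definition frontal I sigma : Prop := exists nu, legendre_curve I sigma nu.

Definition admits_generalized_frenet_frame I gamma : Prop :=
  exists (alpha : R -> R) tau,
    [/\ smooth_on I alpha,
        smooth_on I tau,
        forall t, I t -> unit_sphere (tau t),
        forall t, I t -> deriv_on I gamma t = alpha t *: tau t
      & frontal I tau].

Definition regular_curve I gamma : Prop :=
  smooth_on I gamma /\ forall t, I t -> deriv_on I gamma t != 0.

Definition frenet_curve I gamma : Prop :=
  regular_curve I gamma /\
  forall t, I t ->
    free [:: deriv_on I gamma t; deriv_on I (deriv_on I gamma) t].

End Curves.

(* Main.v *)
Require Import Defs.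
From mathcomp Require Import all_boot all_order all_algebra.
From mathcomp Require Import all_classical all_reals all_analysis.
From mathcomp Require Import ring.

Set Implicit Arguments.
Unset Strict Implicit.
Unset Printing Implicit Defensive.

Import Order.TTheory GRing.Theory Num.Theory.
Import numFieldNormedType.Exports.

Local Open Scope classical_set_scope.
Local Open Scope ring_scope.

(** Take for tau the normalized velocity v / |v|, where v is the derivative of
gamma and a is that of v, and for its companion nu the normalized binormal
c / |c|, where c = v x a.  Both denominators are nonzero: v does not vanish
since gamma is regular, and |v x a|^2 = |v|^2 |a|^2 - <v, a>^2
([lagrange_identity]) vanishes only if v and a are dependent ([cross_neq0]).
The derivative of tau is a combination of v and a, hence orthogonal to nu, so
that (tau, nu) is a Legendre curve, and v = |v| tau is the required
factorization.

What remains is smoothness.  Everything is obtained from v and a by sums,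
products, coordinates and f |-> 1 / sqrt f for f > 0, so it is enough that
C^k functions are closed under these operations, by induction on k.  The
induction is run on [Ck], which asks for the existence of a derivative of class
C^(k-1) instead of iterating the limit operator [deriv_on]; the induction is
then independent of the uniqueness of limits.  The two notions agree when every
point of I is an accumulation point of I ([smooth_on_Ck], [Ck_smooth_on]), and
this follows from the Frenet condition ([frenet_curve_acc]). *)

(** * Derivatives relative to a set *)

Section HasDeriv.
Context {R : realType}.
Implicit Types (I : set R) (t : R).

Definition has_deriv {V : normedModType R} I (f : R -> V) t (l : V) : Prop :=
  diff_quot f t s @[s --> within I t^'] --> l.

Lemma near_within_neq I t : \forall s \near within I t^', I s /\ s - t != 0.
Proof.
near=> s; split; first by near: s; exact: withinT.
rewrite subr_eq0; near: s.
have : \forall s \near t^', s != t by exact: nbhs_dnbhs_neq.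
exact: cvg_within.
Unshelve. all: by end_near. Qed.

Lemma within_dnbhs_cvg I t : s @[s --> within I t^'] --> t.
Proof. by move=> A tA; apply: cvg_within; exact: nbhs_dnbhs. Qed.

Lemma has_deriv_ext {V : normedModType R} I (f g : R -> V) t l : I t ->
  (forall s, I s -> f s = g s) -> has_deriv I f t l -> has_deriv I g t l.
Proof.
move=> It fg; apply: cvg_trans; apply: near_eq_cvg; near=> s.
have [Is _] : I s /\ s - t != 0 by near: s; exact: near_within_neq.
by rewrite /diff_quot !fg.
Unshelve. all: by end_near. Qed.

(** Near t one has f s = (s - t) *: diff_quot f t s + f t, and the first factor
tends to 0. *)
Lemma has_deriv_continuous {V : normedModType R} I (f : R -> V) t l :
  has_deriv I f t l -> f s @[s --> within I t^'] --> f t.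
Proof.
move=> fl.
have -> : f t = (t - t) *: l + f t by rewrite subrr scale0r add0r.
have : (s - t) *: diff_quot f t s + f t @[s --> within I t^']
    --> (t - t) *: l + f t.
  apply: cvgD; last exact: cvg_cst.
  apply: cvgZ => //; apply: cvgB; last exact: cvg_cst.
  exact: within_dnbhs_cvg.
apply: cvg_trans; apply: near_eq_cvg; near=> s.
have [_ st] : I s /\ s - t != 0 by near: s; exact: near_within_neq.
by rewrite /diff_quot scalerA divff// scale1r subrK.
Unshelve. all: by end_near. Qed.

Lemma has_deriv_cst {V : normedModType R} I (v : V) t :
  has_deriv I (fun=> v) t 0.
Proof.
rewrite /has_deriv; have -> : diff_quot (fun=> v) t = (fun=> 0).
  by apply: funext => s; rewrite /diff_quot subrr scaler0.
exact: cvg_cst.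
Qed.

Lemma has_derivD {V : normedModType R} I (f g : R -> V) t k l :
  has_deriv I f t k -> has_deriv I g t l ->
  has_deriv I (fun s => f s + g s) t (k + l).
Proof.
move=> fk gl; rewrite /has_deriv.
have -> : diff_quot (fun s => f s + g s) t =
    (fun s => diff_quot f t s + diff_quot g t s).
  by apply: funext => s; rewrite /diff_quot -scalerDr opprD addrACA.
exact: cvgD.
Qed.

Lemma has_derivZ {V : normedModType R} I (f : R -> R) (g : R -> V) t k l :
  has_deriv I f t k -> has_deriv I g t l ->
  has_deriv I (fun s => f s *: g s) t (k *: g t + f t *: l).
Proof.
move=> fk gl; rewrite /has_deriv.
have -> : diff_quot (fun s => f s *: g s) t =
    (fun s => diff_quot f t s *: g t + f s *: diff_quot g t s).
  apply: funext => s; rewrite /diff_quot.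
  have -> : f s *: g s - f t *: g t = (f s - f t) *: g t + f s *: (g s - g t).
    by rewrite scalerBl scalerBr [RHS]addrC subrKA.
  by rewrite scalerDr !scalerA (mulrC (f s)).
apply: cvgD; apply: cvgZ => //; first exact: cvg_cst.
exact: has_deriv_continuous fk.
Qed.

Lemma has_deriv_coord n I (f : R -> 'rV[R]_n.+1) t l i :
  has_deriv I f t l -> has_deriv I (fun s => f s 0 i) t (l 0 i).
Proof.
move=> fl; rewrite /has_deriv.
have -> : diff_quot (fun s => f s 0 i) t = (fun s => diff_quot f t s 0 i).
  by apply: funext => s; rewrite /diff_quot !mxE.
apply: (@continuous_cvg _ _ _ _ _ _ (fun M : 'rV[R]_n.+1 => M 0 i)) => //.
exact: coord_continuous.
Qed.

(** With w = 1 / sqrt f one has f = 1 / w^2, so the difference quotient of w is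
the opposite of that of f times w(s)^2 w(t)^2 / (w(s) + w(t)); this only needs
the continuity of w. *)
Lemma has_deriv_invsqrt I (f : R -> R) t k : I t ->
  (forall s, I s -> 0 < f s) -> has_deriv I f t k ->
  has_deriv I (fun s => (Num.sqrt (f s))^-1) t
    (- 2^-1 * (Num.sqrt (f t))^-1 ^+ 3 * k).
Proof.
move=> It f0 fk; set w := fun s => (Num.sqrt (f s))^-1.
have w0 s : I s -> 0 < w s by move=> Is; rewrite invr_gt0 sqrtr_gt0 f0.
have wf s : I s -> f s = (w s ^+ 2)^-1.
  by move=> Is; rewrite exprVn invrK sqr_sqrtr// ltW// f0.
have wt : w s @[s --> within I t^'] --> w t.
  apply: cvgV; first by rewrite gt_eqF// sqrtr_gt0 f0.
  apply: (@continuous_cvg _ _ _ _ _ _ Num.sqrt); first exact: sqrt_continuous.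
  exact: has_deriv_continuous fk.
have -> : - 2^-1 * (Num.sqrt (f t))^-1 ^+ 3 * k =
    - k * ((w t * w t) * (w t * w t) * (w t + w t)^-1).
  by rewrite -/(w t); field; rewrite gt_eqF// ?w0// addr_gt0// w0.
rewrite /has_deriv.
have : - diff_quot f t s *
    ((w s * w s) * (w t * w t) * (w s + w t)^-1) @[s --> within I t^'] -->
    - k * ((w t * w t) * (w t * w t) * (w t + w t)^-1).
  apply: cvgM; first exact: cvgN.
  apply: cvgM.
    by apply: cvgM; [exact: cvgM|exact: cvg_cst].
  apply: cvgV; first by rewrite gt_eqF// addr_gt0// w0.
  by apply: cvgD => //; exact: cvg_cst.
apply: cvg_trans; apply: near_eq_cvg; near=> s.
have [Is st] : I s /\ s - t != 0 by near: s; exact: near_within_neq.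
rewrite /diff_quot !wf// /GRing.scale/=.
have := w0 _ Is; have := w0 _ It; move: (w s) (w t) => x y y0 x0.
by field; rewrite st !gt_eqF// addr_gt0.
Unshelve. all: by end_near. Qed.

End HasDeriv.

(** * Functions of class C^k *)

Section Ck.
Context {R : realType}.
Variable I : set R.

(** Existence of k successive derivatives on I.  The derivative is an
existentially quantified function whose values outside I are free, so explicit
derivation formulas can be supplied as witnesses. *)
Fixpoint Ck {V : normedModType R} n (f : R -> V) : Prop :=
  if n is n'.+1 then
    exists2 g, forall t, I t -> has_deriv I f t (g t) & Ck n' g
  else True.

Lemma Ck_ext {V : normedModType R} n (f g : R -> V) :
  (forall s, I s -> f s = g s) -> Ck n f -> Ck n g.
Proof.
case: n => // n fg [h fh Ch]; exists h => // t It.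
exact: has_deriv_ext (fh t It).
Qed.

Lemma CkW {V : normedModType R} n (f : R -> V) : Ck n.+1 f -> Ck n f.
Proof.
elim: n f => // n IH f [g fg Cg]; exists g => //; exact: IH.
Qed.

Lemma Ck_cst {V : normedModType R} n (v : V) : Ck n (fun=> v).
Proof.
by elim: n v => // n IH v; exists (fun=> 0) => // t _; exact: has_deriv_cst.
Qed.

Lemma CkD {V : normedModType R} n (f g : R -> V) :
  Ck n f -> Ck n g -> Ck n (fun s => f s + g s).
Proof.
elim: n f g => // n IH f g [f' ff' Cf'] [g' gg' Cg'].
exists (fun s => f' s + g' s); last exact: IH.
by move=> t It; apply: has_derivD; [exact: ff'|exact: gg'].
Qed.

Lemma CkZ {V : normedModType R} n (f : R -> R) (g : R -> V) :
  Ck n f -> Ck n g -> Ck n (fun s => f s *: g s).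
Proof.
elim: n f g => // n IH f g Cf Cg.
have [[f' ff' Cf'] [g' gg' Cg']] := (Cf, Cg).
exists (fun s => f' s *: g s + f s *: g' s).
  by move=> t It; apply: has_derivZ; [exact: ff'|exact: gg'].
by apply: CkD; apply: IH => //; exact: CkW.
Qed.

Lemma CkM n (f g : R -> R) : Ck n f -> Ck n g -> Ck n (fun s => f s * g s).
Proof. exact: CkZ. Qed.

Lemma Ck_sum {V : normedModType R} n m (f : 'I_m -> R -> V) :
  (forall i, Ck n (f i)) -> Ck n (fun s => \sum_(i < m) f i s).
Proof.
elim: m f => [|m IH] f Cf.
  by apply: Ck_ext (Ck_cst n 0) => s _; rewrite big_ord0.
apply: (@Ck_ext _ _ (fun s => f ord0 s + \sum_(i < m) f (lift ord0 i) s)).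
  by move=> s _; rewrite big_ord_recl.
by apply: CkD => //; exact: IH.
Qed.

Lemma Ck_coord m n (f : R -> 'rV[R]_m.+1) i : Ck n f -> Ck n (fun s => f s 0 i).
Proof.
elim: n f => // n IH f [g fg Cg]; exists (fun s => g s 0 i); last exact: IH.
by move=> t It; apply: has_deriv_coord; exact: fg.
Qed.

(** The derivative of w = 1 / sqrt f is - w^3 f' / 2, a product of functions
that are of class C^n by induction. *)
Lemma Ck_invsqrt n (f : R -> R) : (forall s, I s -> 0 < f s) ->
  Ck n f -> Ck n (fun s => (Num.sqrt (f s))^-1).
Proof.
move=> f0; elim: n => // n IH Cf.
have [f' ff' Cf'] := Cf; have Cw := IH (CkW Cf).
exists (fun s => - 2^-1 * (Num.sqrt (f s))^-1 ^+ 3 * f' s).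
  by move=> t It; apply: has_deriv_invsqrt => //; exact: ff'.
apply: CkM => //; apply: CkM; first exact: Ck_cst.
by apply: CkM => //; exact: CkM.
Qed.

Lemma Ck_row m n (f : R -> 'rV[R]_m.+1) :
  (forall i, Ck n (fun s => f s 0 i)) -> Ck n f.
Proof.
move=> Cf.
apply: (@Ck_ext _ _ (fun s => \sum_(i < m.+1) f s 0 i *: delta_mx 0 i)).
  by move=> s _; rewrite -row_sum_delta.
by apply: Ck_sum => i; apply: CkZ => //; exact: Ck_cst.
Qed.

Lemma smooth_on_Ck {V : normedModType R} (f : R -> V) :
  smooth_on I f -> forall n, Ck n f.
Proof.
move=> + n; elim: n f => // n IH f sf; exists (deriv_on I f).
  by move=> t It; exact: (sf 0).
by apply: IH => m t It; rewrite -iterSr; exact: sf.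
Qed.

(* Accumulation at each point of I makes limits along I unique, which identifies
   the witnesses of [Ck] with [deriv_on]. *)
Hypothesis accI : forall t, I t -> ProperFilter (within I t^').

Lemma has_deriv_onE {V : normedModType R} (f : R -> V) t l : I t ->
  has_deriv I f t l -> deriv_on I f t = l.
Proof. by move=> It fl; have ? := accI It; exact: cvg_lim fl. Qed.

Lemma Ck_smooth_on {V : normedModType R} (f : R -> V) :
  (forall n, Ck n f) -> smooth_on I f.
Proof.
move=> Cf n t It; move: (Cf n.+1) => {Cf}; elim: n f => [|n IH] f.
  by move=> [g fg _]; apply/cvg_ex; exists (g t); exact: fg.
move=> [g fg Cg]; rewrite iterSr; apply: IH; apply: (@Ck_ext _ n.+1 g) => // s Is.
by rewrite (has_deriv_onE Is (fg s Is)).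
Qed.

End Ck.

(** * The inner and cross products of R^3 *)

Section Euclid.
Context {R : realType}.
Implicit Types u v : 'rV[R]_3.

(** Indices are taken modulo 3, so that a single formula gives the three
coordinates. *)
Definition cross u v : 'rV[R]_3 :=
  \row_i (u 0 (i + 1) * v 0 (i + 2) - u 0 (i + 2) * v 0 (i + 1)).

Lemma innerZl a u v : inner (a *: u) v = a * inner u v.
Proof. by rewrite /inner mulr_sumr; apply: eq_bigr => i _; rewrite mxE mulrA. Qed.

Lemma innerC u v : inner u v = inner v u.
Proof. by apply: eq_bigr => i _; rewrite mulrC. Qed.

Lemma innerDl u v w : inner (u + v) w = inner u w + inner v w.
Proof.
by rewrite /inner -big_split; apply: eq_bigr => i _ /=; rewrite mxE mulrDl.
Qed.

Lemma inner_ge0 u : 0 <= inner u u.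
Proof. by apply: sumr_ge0 => i _; rewrite -expr2 sqr_ge0. Qed.

Lemma inner_eq0 u : (inner u u == 0) = (u == 0).
Proof.
apply/idP/eqP => [|->]; last by rewrite -(scale0r 0) innerZl mul0r.
rewrite psumr_eq0 => [/allP u0|i _]; last by rewrite -expr2 sqr_ge0.
apply/rowP => i; rewrite mxE.
by have := u0 i (mem_index_enum _); rewrite mulf_eq0 orbb => /eqP.
Qed.

Lemma inner_gt0 u : (0 < inner u u) = (u != 0).
Proof. by rewrite lt_def inner_ge0 inner_eq0 andbT. Qed.

Lemma inner3E u v : inner u v = u 0 0 * v 0 0 + u 0 1 * v 0 1 + u 0 2 * v 0 2.
Proof.
rewrite /inner !big_ord_recl big_ord0 addr0 addrA.
by congr (_ + _ * _ + _ * _); congr (_ 0 _); exact/val_inj.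
Qed.

Lemma cross3E u v : [/\ cross u v 0 0 = u 0 1 * v 0 2 - u 0 2 * v 0 1,
  cross u v 0 1 = u 0 2 * v 0 0 - u 0 0 * v 0 2 &
  cross u v 0 2 = u 0 0 * v 0 1 - u 0 1 * v 0 0].
Proof.
by split; rewrite mxE; congr (_ * _ - _ * _); congr (_ 0 _); exact/val_inj.
Qed.

Lemma inner_crossl u v : inner u (cross u v) = 0.
Proof. by rewrite inner3E; have [-> -> ->] := cross3E u v; ring. Qed.

Lemma inner_crossr u v : inner v (cross u v) = 0.
Proof. by rewrite inner3E; have [-> -> ->] := cross3E u v; ring. Qed.

Lemma lagrange_identity u v : inner (cross u v) (cross u v) =
  inner u u * inner v v - inner u v ^+ 2.
Proof. by rewrite !inner3E; have [-> -> ->] := cross3E u v; ring. Qed.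

(** If u x v = 0, then u minus its projection <u, v> / <v, v> *: v has squared
norm |u x v|^2 / |v|^2 = 0, so u lies on the line of v. *)
Lemma cross_neq0 u v : free [:: u; v] -> cross u v != 0.
Proof.
rewrite free_cons span_seq1 => /andP[uv]; rewrite seq1_free => v0.
apply: contra uv => /eqP c0; apply/vlineP.
have vv0 : inner v v != 0 by rewrite inner_eq0.
have := lagrange_identity u v.
rewrite c0 (eqP (_ : inner 0 0 == 0)) ?inner_eq0// => /esym L.
exists (inner u v / inner v v); apply/eqP; rewrite -subr_eq0 -inner_eq0.
rewrite innerDl -scaleNr innerZl ![inner _ (_ + _)]innerC !innerDl !innerZl.
rewrite (innerC v u); apply/eqP.
transitivity ((inner u u * inner v v - inner u v ^+ 2) / inner v v).
  by field.
by rewrite L mul0r.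
Qed.

Lemma inner_normalize u : u != 0 ->
  inner ((Num.sqrt (inner u u))^-1 *: u) ((Num.sqrt (inner u u))^-1 *: u) = 1.
Proof.
rewrite -inner_gt0 => u0; rewrite innerZl innerC innerZl mulrA -expr2 exprVn.
by rewrite sqr_sqrtr ?inner_ge0// mulVf// gt_eqF.
Qed.

Lemma Ck_inner (I : set R) n (f g : R -> 'rV[R]_3) : Ck I n f -> Ck I n g ->
  Ck I n (fun s => inner (f s) (g s)).
Proof. by move=> Cf Cg; apply: Ck_sum => i; apply: CkM; exact: Ck_coord. Qed.

Lemma Ck_cross (I : set R) n (f g : R -> 'rV[R]_3) : Ck I n f -> Ck I n g ->
  Ck I n (fun s => cross (f s) (g s)).
Proof.
move=> Cf Cg; apply: Ck_row => i.
apply: (@Ck_ext _ _ _ _ (fun s => f s 0 (i + 1) * g s 0 (i + 2)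
    + -1 * (f s 0 (i + 2) * g s 0 (i + 1)))).
  by move=> s _; rewrite mxE mulN1r.
apply: CkD; first by apply: CkM; exact: Ck_coord.
by apply: CkM; [exact: Ck_cst|apply: CkM; exact: Ck_coord].
Qed.

End Euclid.

(** * The frame of a Frenet curve *)

(** At an isolated point t of I the filter of punctured neighbourhoods of t in I
is improper, so [deriv_on] takes there the same value on all maps; the velocity
and the acceleration would then coincide, against their independence. *)
Lemma frenet_curve_acc (R : realType) (I : set R) (gamma : R -> 'rV[R]_3) t :
  frenet_curve I gamma -> I t -> ProperFilter (within I t^').
Proof.
move=> [_ fr] It; apply: Build_ProperFilter_ex => A FA.
apply: contrapT => /forallNP A0.
have F0 (B : set R) : within I t^' B.
  by apply: filterS FA => s /A0.
have Dcst : deriv_on I gamma t = deriv_on I (deriv_on I gamma) t.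
  rewrite /deriv_on; congr lim.
  by apply/seteqP; split => B _; exact: F0.
have := fr t It; rewrite -Dcst free_cons span_seq1.
by rewrite memv_line.
Qed.

Theorem mainTheorem3 (R : realType) (I : set R) (gamma : R -> 'rV[R]_3) :
  is_interval I -> frenet_curve I gamma ->
  admits_generalized_frenet_frame I gamma.
Proof.
move=> _ Fg; have accI t : I t -> ProperFilter (within I t^').
  exact: frenet_curve_acc Fg.
have [[sg g0] fr] := Fg.
set v := deriv_on I gamma; set a := deriv_on I v.
have Cv n : Ck I n v.
  by apply: smooth_on_Ck => m t It; rewrite -iterSr; exact: sg.
have Ca n : Ck I n a.
  by apply: smooth_on_Ck => m t It; rewrite -!iterSr; exact: sg.
have va t : I t -> has_deriv I v t (a t) by exact: (sg 1%N).
pose q s := inner (v s) (v s); pose w s := (Num.sqrt (q s))^-1.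
pose c s := cross (v s) (a s); pose p s := inner (c s) (c s).
have q0 s : I s -> 0 < q s by move=> Is; rewrite inner_gt0 g0.
have c0 s : I s -> c s != 0 by move=> Is; apply: cross_neq0; exact: fr.
have p0 s : I s -> 0 < p s by move=> Is; rewrite inner_gt0 c0.
have Cq n : Ck I n q by exact: Ck_inner.
have Cw n : Ck I n w by exact: Ck_invsqrt.
have Cc n : Ck I n c by exact: Ck_cross.
have stau : smooth_on I (fun s => w s *: v s).
  by apply: Ck_smooth_on => // n; exact: CkZ.
(* q s * w s = q s / sqrt (q s) is the speed, in a form whose smoothness follows
   from that of products. *)
exists (fun s => q s * w s), (fun s => w s *: v s); split => //.
- by apply: Ck_smooth_on => // n; exact: CkM.
- by move=> t It; apply: inner_normalize; exact: g0.
- move=> t It; rewrite scalerA -mulrA -expr2 exprVn sqr_sqrtr ?inner_ge0//.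
  by rewrite divff ?scale1r// gt_eqF// q0.
exists (fun s => (Num.sqrt (p s))^-1 *: c s); split; first exact: stau.
- apply: Ck_smooth_on => // n; apply: CkZ => //.
  by apply: Ck_invsqrt => //; exact: Ck_inner.
- move=> t It; split => /=.
  + by apply: inner_normalize; exact: g0.
  + by apply: inner_normalize; exact: c0.
  + by rewrite innerZl innerC innerZl innerC inner_crossl !mulr0.
- move=> t It; have [w' ww' _] := Cw 1%N.
  rewrite (has_deriv_onE accI It (has_derivZ (ww' t It) (va t It))).
  rewrite innerC innerZl innerC innerDl !innerZl.
  by rewrite inner_crossl inner_crossr !mulr0 addr0 mulr0.
Qed.
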